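(* For all integers $i,j\ge 1$, \[|\beta_{i,j}|\le \frac12\sqrt{\frac1i+\frac1j}.\]
   Context: For a graph on $n$ vertices, $\lambda_1\ge\cdots\ge\lambda_n$ are the eigenvalues of its adjacency matrix. Let $\mathcal G_n$ be the family of simple graphs on $n$ vertices, with $\overline{G}$ the usual complement. For fixed positive integers $i,j$, \[\beta_{i,j}=\lim_{n\to\infty}\frac1n\min_{G\in\mathcal G_n}\bigl(\lambda_{n-i+1}(G)+\lambda_{n-j+1}(\overline{G})\bigr),\] a limit which is known to exist (Nikiforov). *)

(* Defs.v *)
From HB Require Import structures.
From mathcomp Require Import all_boot all_order all_algebra.
From mathcomp Require Import polyrcf.
From mathcomp Require Import all_classical all_reals all_analysis.

Set Implicit Arguments.
Unset Strict Implicit.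
Unset Printing Implicit Defensive.

Import Order.TTheory GRing.Theory Num.Theory.
Import numFieldNormedType.Exports.

Local Open Scope ring_scope.

Definition simple_graph n (e : {ffun 'I_n * 'I_n -> bool}) : bool :=
  [forall x, ~~ e (x, x)] && [forall x, forall y, e (x, y) == e (y, x)].

Record sgraph n := SGraph {
  edge : {ffun 'I_n * 'I_n -> bool};
  edgeP : simple_graph edge
}.

HB.instance Definition _ n := [isSub for @edge n].
HB.instance Definition _ n := [Finite of sgraph n by <:].

Definition compl_edge n (G : sgraph n) : {ffun 'I_n * 'I_n -> bool} :=
  [ffun p => (p.1 != p.2) && ~~ edge G p].

Lemma compl_edgeP n (G : sgraph n) : simple_graph (compl_edge G).
Proof.
have /andP[_ /forallP Gsym] := edgeP G.
apply/andP; split; first by apply/forallP => x; rewrite ffunE eqxx.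
apply/forallP => x; apply/forallP => y; rewrite !ffunE /= (eq_sym x).
by have /forallP/(_ y)/eqP-> := Gsym x.
Qed.

Definition compl n (G : sgraph n) : sgraph n := SGraph (compl_edgeP G).

Lemma empty_edgeP n : simple_graph [ffun _ : 'I_n * 'I_n => false].
Proof.
apply/andP; split; first by apply/forallP => x; rewrite ffunE.
by apply/forallP => x; apply/forallP => y; rewrite !ffunE.
Qed.

Definition empty_graph n : sgraph n := SGraph (empty_edgeP n).

Definition adjmx (R : realType) n (G : sgraph n) : 'M[R]_n :=
  \matrix_(x, y) (edge G (x, y))%:R.

(* The real eigenvalues, in nonincreasing order and repeated according to
   algebraic multiplicity; [rootsR] lists distinct roots increasingly.  For a
   symmetric [A] this list has exactly [n] entries. *)
Definition eigenvalues (R : realType) n (A : 'M[R]_n) : seq R :=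
  flatten [seq nseq (mup x (char_poly A)) x | x <- rev (rootsR (char_poly A))].

(* Indexed from 1, so that [lambda G 1] is the largest eigenvalue; the value
   is the junk value 0 for k > n, and [lambda G 0] is [lambda G 1]. *)
Definition lambda (R : realType) n (G : sgraph n) (k : nat) : R :=
  nth 0 (eigenvalues (adjmx R G)) k.-1.

(* The empty graph serves only as the seed of the iterated minimum over the
   nonempty finite type [sgraph n]. *)
Definition min_graph (R : realType) n (F : sgraph n -> R) : R :=
  \big[Num.min/F (empty_graph n)]_(G : sgraph n) F G.

(* The subtraction on indices is truncated, which affects only the finitely
   many terms with n < i or n < j. *)
Definition beta_seq (R : realType) (i j : nat) (n : nat) : R :=
  n%:R^-1 * min_graph (fun G : sgraph n =>
    lambda R G (n - i + 1) + lambda R (compl G) (n - j + 1)).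

Definition beta (R : realType) (i j : nat) : R :=
  limn (beta_seq R i j).

(* Main.v *)
(* Write A and B for the adjacency matrices of G and of its complement, J for
   the all-ones matrix, and S = A - B.  Since A + B + I = J, we have
   2 A + I = S + J and 2 B + I = - S + J with J positive semidefinite.  Hence S
   has, in the quadratic form sense, i directions on which it is at most
   2 lambda_(n-i+1)(G) + 1 and j directions on which - S is at most
   2 lambda_(n-j+1)(compl G) + 1.  With a and b the positive parts of the
   opposites of these bounds this gives i a^2 + j b^2 <= tr S^2 <= n^2, and
   Cauchy-Schwarz yields a + b <= n sqrt(1/i + 1/j), the lower bound on beta.
   For the upper bound, tr A^2 <= n^2 forces lambda_(n-i+1)(G) = o(n) whenever
   it is nonnegative, for every graph G. *)
Require Import Defs.
From mathcomp Require Import all_boot all_order all_algebra.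
From mathcomp Require Import polyrcf complex.
From mathcomp Require Import all_classical all_reals all_analysis.
From mathcomp Require Import ring lra.

Set Implicit Arguments.
Unset Strict Implicit.
Unset Printing Implicit Defensive.

Import Order.TTheory GRing.Theory Num.Theory.
Import numFieldNormedType.Exports.
Local Open Scope ring_scope.
Local Open Scope sesquilinear_scope.

(** * Spectral decomposition of real symmetric matrices *)

Local Notation toC R := (real_complex R).

(* The rows of [U] are an orthonormal eigenbasis; it is complex because the
   library's spectral theorem is over an algebraically closed field. *)
Definition spectral_dec (R : realType) n (A : 'M[R]_n) (U : 'M[R[i]]_n)
    (d : 'I_n -> R) : Prop :=
  U \is unitarymx /\ U *m map_mx (toC R) A = diag_mx (\row_k (d k)%:C%C) *m U.

Lemma spectral_dec_sym (R : realType) n (A : 'M[R]_n) :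
  A^T = A -> exists U d, spectral_dec A U d.
Proof.
move=> symA; set B := map_mx (toC R) A.
have hermB : B \is hermsymmx.
  apply: realsym_hermsym.
    apply/is_hermitianmxP; rewrite expr0 scale1r.
    by apply/matrixP => x y; rewrite !mxE -[in LHS]symA mxE.
  by apply/mxOverP => x y; rewrite mxE; apply/complex_realP; exists (A x y).
have realB := hermitian_spectral_diag_real hermB.
have /orthomx_spectralP eqB := hermitian_normalmx hermB.
exists (spectralmx B), (fun k => complex.Re (spectral_diag B 0 k)).
split; first exact: spectral_unitarymx.
rewrite -/B [X in _ *m X]eqB !mulmxA (mulmxV (spectral_unit B)) mul1mx.
congr (diag_mx _ *m _); apply/rowP => k; rewrite mxE RRe_real//.
exact: (mxOverP realB).
Qed.

Lemma spectral_dec_affine (R : realType) n (A : 'M[R]_n) U d a b :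
  spectral_dec A U d -> spectral_dec (a *: A + b%:M) U (fun k => a * d k + b).
Proof.
move=> [unitU eqA]; split=> //.
rewrite map_mxD map_mxZ map_scalar_mx mulmxDr -scalemxAr eqA scalemxAl.
rewrite scalar_mxC -mulmxDl; congr (_ *m _).
apply/matrixP => x y; rewrite !mxE; case: (x == y); rewrite ?mulr1n ?mulr0n//.
  by rewrite rmorphD rmorphM.
by rewrite mulr0 addr0.
Qed.

Lemma spectral_dec_trace_sqr (R : realType) n (A : 'M[R]_n) U d :
  spectral_dec A U d -> \sum_k d k ^+ 2 = \tr (A *m A).
Proof.
move=> [unitU eqA]; apply: complexI; have uU := unitarymx_unit unitU.
set D := diag_mx _ in eqA.
have {}eqA : map_mx (toC R) A = invmx U *m (D *m U) by rewrite -eqA mulKmx.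
rewrite -[RHS]trace_map_mx map_mxM eqA mulmxA mxtrace_mulC !mulmxA.
rewrite !mulmxK// mulmx_diag mxtrace_diag rmorph_sum.
by apply: eq_bigr => k _; rewrite !mxE rmorphXn expr2.
Qed.

Lemma spectral_dec_char_poly (R : realType) n (A : 'M[R]_n) U d :
  spectral_dec A U d -> char_poly A = \prod_k ('X - (d k)%:P).
Proof.
move=> [unitU eqA]; have uU := unitarymx_unit unitU.
apply: (map_poly_inj (toC R)); rewrite map_char_poly.
set D := diag_mx _ in eqA.
have detU : \det (map_mx polyC U) != 0 by rewrite det_map_mx polyC_eq0 -unitfE -unitmxE.
have -> : char_poly (map_mx (toC R) A) = char_poly D.
  (* Cancelling [\det U] reduces similarity to the intertwining relation U (X - A) = (X - D) U. *)
  apply: (mulfI detU); rewrite /char_poly -[RHS]mulrC -!det_mulmx; congr (\det _).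
  by rewrite /char_poly_mx mulmxBr mulmxBl -!map_mxM eqA scalar_mxC.
rewrite char_poly_trig ?diag_mx_is_trig// rmorph_prod; apply: eq_bigr => k _.
by rewrite !mxE eqxx mulr1n rmorphB/= map_polyX map_polyC.
Qed.

(** * The ordered list of eigenvalues and counting in it *)

Lemma sorted_flatten_nseq (R : realType) (m : R -> nat) (s : seq R) :
  sorted >%R s -> sorted >=%R (flatten [seq nseq (m x) x | x <- s]).
Proof.
rewrite (sorted_pairwise (fun _ _ _ h1 h2 => lt_trans h2 h1)).
rewrite (sorted_pairwise (fun _ _ _ h1 h2 => le_trans h2 h1)).
elim: s => //= x s IHs /andP[/allP xs /IHs ps].
rewrite pairwise_cat ps andbT; apply/andP; split.
  apply/allrelP => y z /nseqP[-> _] /flattenP[_ /mapP[w ws ->] /nseqP[-> _]].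
  by rewrite /= ltW// xs.
elim: (m x) => //= k ->; rewrite andbT; apply/allP => y /nseqP[-> _].
exact: lexx.
Qed.

Lemma count_mem_flatten_nseq (T : eqType) (m : T -> nat) (s : seq T) y :
  uniq s -> count_mem y (flatten [seq nseq (m x) x | x <- s]) =
            if y \in s then m y else 0%N.
Proof.
elim: s => //= x s IHs /andP[xs /IHs IH].
rewrite count_cat IH count_nseq inE /= eq_sym.
by case: eqVneq => [->|]; rewrite ?(negbTE xs) ?mul1n ?addn0.
Qed.

(** Each value occurs in both lists as often as its multiplicity as a root of the characteristic
    polynomial, which [d] splits into linear factors. *)
Lemma eigenvalues_spectral_dec (R : realType) n (A : 'M[R]_n) U d :
  spectral_dec A U d ->
  sorted >=%R (eigenvalues A) /\ perm_eq (eigenvalues A) [seq d k | k <- enum 'I_n].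
Proof.
move=> specA; have eqchar := spectral_dec_char_poly specA.
have char_neq0 : char_poly A != 0 by rewrite monic_neq0 ?char_poly_monic.
have sortedR : sorted <%R (rootsR (char_poly A)) by exact: sorted_roots.
split; first by apply: sorted_flatten_nseq; rewrite rev_sorted.
apply/allP => x _ /=; apply/eqP; rewrite count_mem_flatten_nseq; last first.
  by rewrite rev_uniq (sorted_uniq lt_trans (@ltxx _ _)).
rewrite mem_rev -(roots_on_rootsR char_neq0) in_itv /=.
have -> : count_mem x [seq d k | k <- enum 'I_n] = mup x (char_poly A).
  by rewrite -mu_prod_XsubC big_map big_enum eqchar.
by case: ifPn => // /mupNroot ->.
Qed.

(** Entries from position [k] on are at most the [k]-th, and the first [k.+1] are at least it. These
    are only inequalities because of ties; counting the indices of [d] avoids choosing a matching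
    between [d] and [s]. *)
Lemma count_nth_sorted (R : realType) n (d : 'I_n -> R) s k :
  sorted >=%R s -> perm_eq s [seq d k | k <- enum 'I_n] -> (k < n)%N ->
  (n - k <= #|[set l | (d l <= nth 0 s k)%R]|)%N /\
  (k < #|[set l | (nth 0 s k <= d l)%R]|)%N.
Proof.
move=> sorted_s perm_s lt_kn.
have size_s : size s = n by rewrite (perm_size perm_s) size_map size_enum_ord.
have cnt (p : pred R) : #|[set l | p (d l)]| = count p s.
  rewrite (permP perm_s) count_map cardE enumT /enum_mem size_filter.
  by apply: eq_count => l /=; rewrite inE.
have anti a b : (a <= b)%N -> (b < n)%N -> nth 0 s b <= nth 0 s a.
  move=> ab bn; have ge_trans : transitive (>=%R : rel R).
    by move=> ? ? ? h1 h2; exact: le_trans h2 h1.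
  apply: (sorted_leq_nth ge_trans (@lexx _ _) 0 sorted_s); rewrite // inE size_s//.
  exact: leq_ltn_trans bn.
split.
  rewrite (cnt (fun x => x <= nth 0 s k)) -[s in count _ s](cat_take_drop k s).
  rewrite count_cat.
  have /eqP -> : count (fun x => x <= nth 0 s k) (drop k s) == size (drop k s).
    rewrite -all_count; apply/(all_nthP 0) => l.
    rewrite size_drop nth_drop size_s => lt_l.
    by apply: anti; rewrite ?leq_addr// -ltn_subRL.
  by rewrite size_drop size_s leq_addl.
rewrite (cnt (fun x => nth 0 s k <= x)) -[s in count _ s](cat_take_drop k.+1 s).
rewrite count_cat.
have /eqP -> : count (fun x => nth 0 s k <= x) (take k.+1 s) == size (take k.+1 s).
  rewrite -all_count; apply/(all_nthP 0) => l; rewrite size_takel ?size_s// => lt_l.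
  by rewrite nth_take//; apply: anti.
by rewrite size_takel ?size_s// leq_addr.
Qed.

(** * Doubly stochastic weights from two eigenbases *)

Definition sqr_normc (R : realType) (z : R[i]) : R :=
  complex.Re z ^+ 2 + complex.Im z ^+ 2.

Lemma sqr_normc_ge0 (R : realType) (z : R[i]) : 0 <= sqr_normc z.
Proof. by rewrite addr_ge0 ?sqr_ge0. Qed.

Lemma sqr_normcE (R : realType) (z : R[i]) : (sqr_normc z)%:C%C = z * z^*%R.
Proof. by rewrite add_Re2_Im2 normCK. Qed.

Lemma unitarymx_sqr_normc_row (R : realType) n (Q : 'M[R[i]]_n) l :
  Q \is unitarymx -> \sum_k sqr_normc (Q l k) = 1.
Proof.
move=> /unitarymxP /matrixP /(_ l l); rewrite !mxE eqxx => eq1.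
apply: complexI; rewrite rmorph_sum [RHS]rmorph1 -[RHS]eq1.
by apply: eq_bigr => k _; rewrite !mxE; exact: sqr_normcE.
Qed.

Lemma unitarymx_sqr_normc_col (R : realType) n (Q : 'M[R[i]]_n) k :
  Q \is unitarymx -> \sum_l sqr_normc (Q l k) = 1.
Proof.
rewrite -trmx_unitary => /(unitarymx_sqr_normc_row k) <-.
by apply: eq_bigr => l _; rewrite mxE.
Qed.

Definition doubly_stochastic (R : realType) n (M : 'I_n -> 'I_n -> R) : Prop :=
  [/\ forall l k, 0 <= M l k, forall l, \sum_k M l k = 1 &
      forall k, \sum_l M l k = 1].

(* The weights are [|<u_l, w_k>|^2], with [u_l] and [w_k] the eigenvectors of
   [A] and [S]: as the all-ones matrix is positive semidefinite,
   [u_l S u_l^* <= u_l A u_l^* = d_l]. *)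
Lemma spectral_dec_overlap (R : realType) n (A S : 'M[R]_n) U W d e :
  spectral_dec A U d -> spectral_dec S W e -> A = S + const_mx 1 ->
  exists M : 'I_n -> 'I_n -> R,
    doubly_stochastic M /\ forall l, \sum_k M l k * e k <= d l.
Proof.
move=> [unitU eqA] [unitW eqS] defA.
have uU := unitarymx_unit unitU; have uW := unitarymx_unit unitW.
pose Q := U *m W^t*.
have unitWt : W^t* \is unitarymx by rewrite trmxC_unitary.
have unitQ : Q \is unitarymx := mul_unitarymx unitU unitWt.
exists (fun l k => sqr_normc (Q l k)); split.
  split=> [l k|l|k]; first exact: sqr_normc_ge0.
    exact: unitarymx_sqr_normc_row.
  exact: unitarymx_sqr_normc_col.
(* [z] pairs the eigenvector u_l with the all-ones vector, so [sqr_normc z] is the contribution of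
   the all-ones matrix to [d l]. *)
move=> l; pose z : R[i] := \sum_x U l x.
suff -> : d l = \sum_k sqr_normc (Q l k) * e k + sqr_normc z.
  by rewrite lerDl sqr_normc_ge0.
have eqA' : U *m map_mx (toC R) A *m U^t* = diag_mx (\row_k (d k)%:C%C).
  by rewrite eqA -(invmx_unitary unitU) (mulmxK uU).
have eqS' : map_mx (toC R) S = W^t* *m diag_mx (\row_k (e k)%:C%C) *m W.
  by rewrite -mulmxA -eqS -(invmx_unitary unitW) (mulKmx uW).
apply: complexI; rewrite rmorphD rmorph_sum.
move/matrixP/(_ l l): eqA'; rewrite [RHS]mxE eqxx mulr1n [RHS]mxE => <-.
have -> : map_mx (toC R) A = map_mx (toC R) S + const_mx 1.
  by rewrite defA map_mxD map_const_mx.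
rewrite mulmxDr mulmxDl eqS' mxE; congr (_ + _).
  rewrite !mulmxA -mulmxA.
  have -> : W *m U^t* = Q^t* by rewrite /Q trmx_mul map_mxM trmxCK.
  rewrite -/Q mul_mx_diag mxE; apply: eq_bigr => k _.
  by rewrite !mxE rmorphM /= sqr_normcE mulrAC.
rewrite mxE; under eq_bigr => x _.
  rewrite !mxE; under eq_bigr do rewrite mxE mulr1. over.
by rewrite -mulr_sumr -rmorph_sum -sqr_normcE.
Qed.

(** Take [t k] to be the part of column [k] in the rows of [K]: the column sums cap it at 1 and the
    row sums give the total. *)
Lemma sum_weights (R : realType) n (M : 'I_n -> 'I_n -> R) (e : 'I_n -> R)
    (K : {set 'I_n}) c :
  doubly_stochastic M -> (forall l, l \in K -> \sum_k M l k * e k <= c) ->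
  exists t : 'I_n -> R,
    [/\ forall k, 0 <= t k <= 1, \sum_k t k = #|K|%:R &
        \sum_k t k * e k <= #|K|%:R * c].
Proof.
move=> [M0 rowM colM] KP; exists (fun k => \sum_(l in K) M l k); split.
- move=> k; rewrite sumr_ge0//= -(colM k) [leRHS](bigID (mem K))/= lerDl.
  exact: sumr_ge0.
- by rewrite exchange_big/= (eq_bigr _ (fun l _ => rowM l)) sumr_const.
- under eq_bigr do rewrite mulr_suml.
  rewrite exchange_big/= mulr_natl -sumr_const; exact: ler_sum.
Qed.

(* [e^2] dominates [- 2 a t e - a^2 t + 2 b s e - b^2 s] for all weights
   [t, s] in [[0, 1]]: the sign of [e] makes one half nonpositive and AM-GM
   bounds the other. *)
Lemma sum_sqr_ge (R : realType) n (M N : 'I_n -> 'I_n -> R) (e : 'I_n -> R)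
    (K L : {set 'I_n}) a b :
  doubly_stochastic M -> doubly_stochastic N ->
  (forall l, l \in K -> \sum_k M l k * e k <= - a) ->
  (forall l, l \in L -> \sum_k N l k * - e k <= - b) ->
  #|K|%:R * Num.max a 0 ^+ 2 + #|L|%:R * Num.max b 0 ^+ 2 <= \sum_k e k ^+ 2.
Proof.
move=> dsM dsN /(sum_weights dsM)[t [t01 sumt te]] /(sum_weights dsN)[s [s01 sums se]].
set a' := Num.max a 0; set b' := Num.max b 0.
have a'0 : 0 <= a' by rewrite le_max lexx orbT.
have b'0 : 0 <= b' by rewrite le_max lexx orbT.
have aa' : a' * a = a' ^+ 2.
  by rewrite /a' /Num.max; case: ltP; rewrite ?mul0r ?expr0n// expr2.
have bb' : b' * b = b' ^+ 2.
  by rewrite /b' /Num.max; case: ltP; rewrite ?mul0r ?expr0n// expr2.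
have pointwise k : (- 2 * a') * (t k * e k) + (- a' ^+ 2) * t k +
    (- 2 * b') * (s k * - e k) + (- b' ^+ 2) * s k <= e k ^+ 2.
  have /andP[t0 t1] := t01 k; have /andP[s0 s1] := s01 k.
  (* As t^2 <= t on [0, 1], the term a'^2 t^2 left by completing the square may be replaced by a'^2
     t; likewise for [s]. *)
  have tt : 0 <= a' ^+ 2 * (t k * (1 - t k)) by rewrite !mulr_ge0 ?sqr_ge0 ?subr_ge0.
  have ss : 0 <= b' ^+ 2 * (s k * (1 - s k)) by rewrite !mulr_ge0 ?sqr_ge0 ?subr_ge0.
  have ta : 0 <= a' * t k by rewrite mulr_ge0.
  have sb : 0 <= b' * s k by rewrite mulr_ge0.
  have taa : 0 <= a' * t k * a' by rewrite mulr_ge0.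
  have sbb : 0 <= b' * s k * b' by rewrite mulr_ge0.
  have [e0|e0] := leP 0 (e k).
    have := mulr_ge0 ta e0; have := sqr_ge0 (e k - b' * s k); lra.
  have := mulr_ge0 sb (ltW (_ : 0 < - e k)); rewrite oppr_gt0 => /(_ e0).
  have := sqr_ge0 (e k + a' * t k); lra.
apply: le_trans (ler_sum _ (fun k _ => pointwise k)).
rewrite !big_split/= -!mulr_sumr sumt sums.
(* The terms in [t k * e k] sum to at least 2 |K| a'^2 and those in [t k] take |K| a'^2 away;
   likewise for [L]. *)
have := ler_wpM2l a'0 te; have := ler_wpM2l b'0 se.
rewrite !(mulrN, mulNr) (mulrCA b') (mulrCA a') aa' bb'; lra.
Qed.

(** * Eigenvalue bounds for a graph and its complement *)

Lemma trace_sqr_le (R : realType) n (S : 'M[R]_n) :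
  S^T = S -> (forall x y, `|S x y| <= 1) -> \tr (S *m S) <= n%:R ^+ 2.
Proof.
move=> symS S1; have sum1 : \sum_(y < n) (1 : R) = n%:R by rewrite sumr_const card_ord.
rewrite expr2 -[X in X * _]sum1 mulr_suml; apply: ler_sum => x _.
rewrite mul1r -sum1 mxE.
apply: ler_sum => y _; rewrite -[in S y x]symS mxE -expr2 -real_normK ?num_real//.
by rewrite expr_le1.
Qed.

Lemma adjmx_sym (R : realType) n (G : sgraph n) : (adjmx R G)^T = adjmx R G.
Proof.
have /andP[_ /forallP symG] := edgeP G; apply/matrixP => x y; rewrite !mxE.
by have /forallP/(_ x)/eqP -> := symG y.
Qed.

Lemma adjmx_le1 (R : realType) n (G : sgraph n) x y : `|adjmx R G x y| <= 1.
Proof. by rewrite mxE; case: (edge G _); rewrite ?normr1 ?normr0. Qed.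

(** The index n - i + 1, counted from 1, is position n - i of the list, which leaves i entries from
    there on. *)
Lemma lambda_count (R : realType) n (G : sgraph n) U d i :
  spectral_dec (adjmx R G) U d -> (1 <= i <= n)%N ->
  (i <= #|[set l | (d l <= lambda R G (n - i + 1))%R]|)%N /\
  (n - i < #|[set l | (lambda R G (n - i + 1) <= d l)%R]|)%N.
Proof.
move=> specG /andP[i1 lein]; have [sorted_e perm_e] := eigenvalues_spectral_dec specG.
have := @count_nth_sorted R n d _ (n - i) sorted_e perm_e.
rewrite ltn_subrL i1 (leq_trans i1 lein) subKn// /lambda addn1; exact.
Qed.

(** At least n - i eigenvalues lie at or above this nonnegative one, and all the squares sum to tr
    A^2. *)
Lemma lambda_sqr_le (R : realType) n (G : sgraph n) i :
  (1 <= i <= n)%N -> 0 <= lambda R G (n - i + 1) ->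
  (n - i)%:R * lambda R G (n - i + 1) ^+ 2 <= n%:R ^+ 2.
Proof.
move=> i1n; set x := lambda _ _ _ => x0.
have [U [d specG]] := spectral_dec_sym (adjmx_sym R G).
have [_ /ltnW] := lambda_count specG i1n; rewrite -/x; set K := [set _ | _] => leK.
apply: le_trans (trace_sqr_le (adjmx_sym R G) (adjmx_le1 R G)).
rewrite -(spectral_dec_trace_sqr specG).
apply: (@le_trans _ _ (\sum_(l in K) x ^+ 2)).
  by rewrite sumr_const -[leRHS]mulr_natl ler_wpM2r ?sqr_ge0// ler_nat.
rewrite [leRHS](bigID (mem K))/= ler_wpDr//.
  by apply: sumr_ge0 => l _; exact: sqr_ge0.
by apply: ler_sum => l; rewrite inE => xl; rewrite lerXn2r// nnegrE// (le_trans x0).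
Qed.

Lemma sum_max_sqr_le (R : realType) n (G : sgraph n) i j :
  (1 <= i <= n)%N -> (1 <= j <= n)%N ->
  i%:R * Num.max (- (2 * lambda R G (n - i + 1) + 1)) 0 ^+ 2 +
  j%:R * Num.max (- (2 * lambda R (compl G) (n - j + 1) + 1)) 0 ^+ 2 <=
    n%:R ^+ 2.
Proof.
move=> i1n j1n; set x := lambda R G _; set y := lambda R (compl G) _.
pose A := adjmx R G; pose B := adjmx R (compl G); pose S := A - B.
have symA := adjmx_sym R G; have symB := adjmx_sym R (compl G).
have symS : S^T = S by rewrite linearB /= symA symB.
have [U [d specA]] := spectral_dec_sym symA.
have [V [f specB]] := spectral_dec_sym symB.
have [W [e specS]] := spectral_dec_sym symS.
have ABJ : A + B + 1%:M = const_mx 1.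
  have /andP[/forallP loopG _] := edgeP G.
  apply/matrixP => p q; rewrite !mxE ffunE /=.
  have [->|_] := eqVneq p q; first by rewrite (negbTE (loopG q)) /=; lra.
  by case: (edge G _) => /=; lra.
have eqA : 2 *: A + 1%:M = S + const_mx 1.
  by rewrite -ABJ /S; apply/matrixP => p q; rewrite !mxE; lra.
(* Writing - S as an affine image of S keeps the eigenbasis [W], so both families of weights act on
   the same [e]. *)
have eqB : 2 *: B + 1%:M = (-1 *: S + 0%:M) + const_mx 1.
  by rewrite -ABJ /S; apply/matrixP => p q; rewrite !mxE; lra.
have [M [dsM Md]] := spectral_dec_overlap (spectral_dec_affine 2 1 specA) specS eqA.
have [N [dsN Nf]] := spectral_dec_overlap (spectral_dec_affine 2 1 specB)
  (spectral_dec_affine (-1) 0 specS) eqB.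
(* S is minus the Seidel matrix of [G]: zero on the diagonal and 1 or -1 elsewhere. *)
have S1 p q : `|S p q| <= 1.
  rewrite !mxE ffunE; case: eqP; case: (edge G _) => /= *;
  by rewrite ?subr0 ?subrr ?sub0r ?normrN ?normr1 ?normr0.
apply: le_trans (trace_sqr_le symS S1).
rewrite -(spectral_dec_trace_sqr specS).
have [leK _] := lambda_count specA i1n; have [leL _] := lambda_count specB j1n.
rewrite -/x in leK; rewrite -/y in leL.
set K := [set _ | _] in leK; set L := [set _ | _] in leL.
apply: le_trans (_ : _ <= #|K|%:R * _ + #|L|%:R * _) _.
  by apply: lerD; apply: ler_wpM2r; rewrite ?sqr_ge0 ?ler_nat.
apply: (sum_sqr_ge dsM dsN) => l; rewrite opprK /K /L inE => dl.
  by apply: le_trans (Md l) _; lra.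
under eq_bigr do rewrite -mulN1r -[X in _ * X]addr0.
by apply: le_trans (Nf l) _; lra.
Qed.

Lemma lambda_compl_ge (R : realType) n (G : sgraph n) i j :
  (1 <= i <= n)%N -> (1 <= j <= n)%N ->
  - (1 + n%:R * (1 / 2 * Num.sqrt (1 / i%:R + 1 / j%:R))) <=
    lambda R G (n - i + 1) + lambda R (compl G) (n - j + 1).
Proof.
move=> i1n j1n; have := sum_max_sqr_le R G i1n j1n.
set x := lambda R G _; set y := lambda R (compl G) _.
set a := Num.max (- (2 * x + 1)) 0; set b := Num.max (- (2 * y + 1)) 0.
set c := Num.sqrt _ => le_n2.
have i0 : (0 : R) < i%:R by rewrite ltr0n; case/andP: i1n.
have j0 : (0 : R) < j%:R by rewrite ltr0n; case/andP: j1n.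
have a0 : 0 <= a by rewrite le_max lexx orbT.
have b0 : 0 <= b by rewrite le_max lexx orbT.
have ax : - (2 * x + 1) <= a by rewrite le_max lexx.
have yb : - (2 * y + 1) <= b by rewrite le_max lexx.
have c2 : c ^+ 2 = 1 / i%:R + 1 / j%:R by rewrite sqr_sqrtr// addr_ge0// divr_ge0// ltW.
(* By [ax] and [yb], x + y >= - 1 - (a + b) / 2. *)
suff : a + b <= n%:R * c by lra.
rewrite -(@ler_pXn2r _ 2)// ?nnegrE ?addr_ge0 ?mulr_ge0 ?sqrtr_ge0//.
rewrite exprMn c2; apply: le_trans (ler_wpM2r _ le_n2); last first.
  by rewrite addr_ge0// divr_ge0// ltW.
rewrite -subr_ge0.
(* The defect in Cauchy-Schwarz is an explicit square. *)
suff -> : (i%:R * a ^+ 2 + j%:R * b ^+ 2) * (1 / i%:R + 1 / j%:R) - (a + b) ^+ 2 =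
    (i%:R * a - j%:R * b) ^+ 2 / (i%:R * j%:R).
  by rewrite divr_ge0 ?sqr_ge0// mulr_ge0// ltW.
by field; rewrite !gt_eqF.
Qed.

(** * Asymptotics and the limit *)

Lemma lambda_le_near (R : realType) i (eps : R) : (1 <= i)%N -> 0 < eps ->
  \forall n \near \oo%classic,
    forall G : sgraph n, lambda R G (n - i + 1) <= n%:R * eps.
Proof.
move=> i1 eps0; near=> n => G.
have lein : (i <= n)%N by near: n; exact: nbhs_infty_ge.
have [x0|x0] := leP 0 (lambda R G (n - i + 1)); last first.
  by rewrite (le_trans (ltW x0))// mulr_ge0// ltW.
have := @lambda_sqr_le R n G i; rewrite i1 lein => /(_ isT x0).
(* An eigenvalue above n eps would force (n - i) eps^2 <= 1, which this threshold excludes. *)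
have big_n : i%:R + (eps ^+ 2)^-1 < n%:R by near: n; exact: nbhs_infty_gtr.
have n0 : (0 : R) < n%:R by rewrite ltr0n (leq_trans i1).
rewrite natrB// => le_n2; rewrite leNgt; apply/negP => lt_x.
have : (n%:R - i%:R) * (n%:R * eps) ^+ 2 <= n%:R ^+ 2.
  apply: le_trans le_n2; rewrite ler_wpM2l ?subr_ge0 ?ler_nat//.
  by rewrite lerXn2r ?nnegrE ?mulr_ge0// ltW.
rewrite exprMn mulrCA -[leRHS]mulr1 ler_pM2l ?exprn_gt0//.
rewrite -ler_pdivlMr ?exprn_gt0// div1r; lra.
Unshelve. all: by end_near.
Qed.

Lemma beta_seq_ge (R : realType) i j n : (1 <= i <= n)%N -> (1 <= j <= n)%N ->
  - (n%:R^-1 + 1 / 2 * Num.sqrt (1 / i%:R + 1 / j%:R)) <= beta_seq R i j n.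
Proof.
move=> i1n j1n; have n0 : (0 : R) < n%:R.
  by case/andP: i1n => i1 lein; rewrite ltr0n (leq_trans i1).
rewrite /beta_seq [leRHS]mulrC ler_pdivlMr// mulNr mulrDl.
rewrite mulVf ?gt_eqF// [_ * n%:R]mulrC.
rewrite /min_graph; elim/big_ind: _ => [|a b ha hb|G _].
- exact: lambda_compl_ge.
- by rewrite le_min ha.
- exact: lambda_compl_ge.
Qed.

(** The minimum is at most its seed, the value at the empty graph; the bound on [lambda] is uniform
    in the graph, so it applies although this graph varies with n. *)
Lemma beta_seq_le_near (R : realType) i j (eps : R) :
  (1 <= i)%N -> (1 <= j)%N -> 0 < eps ->
  \forall n \near \oo%classic, beta_seq R i j n <= eps.
Proof.
move=> i1 j1 eps0; have eps2 : 0 < eps / 2 by rewrite divr_gt0.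
near=> n; have n0 : (0 : R) < n%:R by rewrite ltr0n; near: n; exact: nbhs_infty_gt.
rewrite /beta_seq mulrC ler_pdivrMr// /min_graph.
apply: le_trans (bigmin_le_id _ _ _ _) _.
have -> : eps * n%:R = n%:R * (eps / 2) + n%:R * (eps / 2) by lra.
apply: lerD.
  by move: (empty_graph n); near: n; exact: lambda_le_near.
by move: (compl (empty_graph n)); near: n; exact: lambda_le_near.
Unshelve. all: by end_near.
Qed.

Theorem theorem5 (R : realType) (i j : nat) (hi : (1 <= i)%N) (hj : (1 <= j)%N) :
  `| beta R i j | <= 1 / 2 * Num.sqrt (1 / i%:R + 1 / j%:R).
Proof.
set c := 1 / 2 * _.
have c0 : 0 < c.
  by rewrite mulr_gt0// sqrtr_gt0 addr_gt0// divr_gt0// ltr0n.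
(* [limn] of a divergent sequence is the junk value 0. *)
rewrite /beta; have [cvg_beta|/dvgP ->] := pselect (cvgn (beta_seq R i j)); last first.
  by rewrite /point/= normr0 ltW.
rewrite ler_norml; apply/andP; split; last first.
  (* Every positive constant eventually bounds the sequence from above, in particular [c]. *)
  by apply: limr_le => //; exact: beta_seq_le_near.
(* The slack [eps] absorbs the error term 1/n as soon as n exceeds 1/eps. *)
apply/ler_addgt0Pr => eps eps0; rewrite -lerBlDr.
apply: limr_ge => //; near=> n.
apply: le_trans (beta_seq_ge _ _ _); last 2 first.
- by rewrite hi; near: n; exact: nbhs_infty_ge.
- by rewrite hj; near: n; exact: nbhs_infty_ge.
rewrite -/c opprD addrC lerD2r lerN2 -(invrK eps) lef_pV2 ?posrE ?invr_gt0//.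
  by near: n; exact: nbhs_infty_ger.
by rewrite ltr0n; near: n; exact: nbhs_infty_gt.
Unshelve. all: by end_near.
Qed.
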